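(* Let $n\ge 4$ be an integer and $K_n$ the complete graph on $n$ vertices. (i) If $n$ is even and $v\in V(K_n)$, then the inequality $$x(\delta(\{v\}))-x(E(K_n-v))\le \frac{n-2}{2}$$ defines a facet of $\mathrm{TECSP}(K_n)$. (ii) If $n$ is odd, $v\in V(K_n)$, $h=\{w_1,w_2\}\in E(K_n-v)$, and $f:=\{v,w_1\}$, then the inequality $$x(\delta(\{v\})\setminus\{f\})-x(E(K_n-v)\setminus\{h\})-x_f\le\frac{n-3}{2}$$ defines a facet of $\mathrm{TECSP}(K_n)$.
   Context: All graphs are finite, simple and undirected. $\delta(\{v\})$ is the set of edges incident to $v$; $K_n-v$ is the graph obtained by deleting vertex $v$ and its incident edges. A graph is $2$-edge-connected if it is connected and has no bridges (edges whose removal increases the number of connected components); the empty graph and a single vertex are $2$-edge-connected. For $F\subseteq E$, $x(F)=\sum_{e\in F}x_e$. $\chi^H$ is the incidence vector of $E(H)$ in $\{0,1\}^{E(K_n)}$, and $\mathrm{TECSP}(K_n)=\mathrm{conv}\{\chi^H : H\subseteq K_n\text{ is }2\text{-edge-connected}\}\subseteq\mathbb{R}^{E(K_n)}$. A facet is a face of dimension $\dim(\mathrm{TECSP}(K_n))-1$. *)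

(* Defs.v *)
From HB Require Import structures.
From mathcomp Require Import all_boot all_order all_algebra.
Set Implicit Arguments. Unset Strict Implicit. Unset Printing Implicit Defensive.
Import Order.TTheory GRing.Theory Num.Theory.
Local Open Scope ring_scope.

Definition edge (n : nat) := {e : {set 'I_n} | #|e| == 2%N}.
HB.instance Definition _ n := Finite.on (edge n).

Definition adjF n (F : {set edge n}) : rel 'I_n :=
  fun u w => [exists e in F, val e == [set u; w]].

Definition subgraph n (W : {set 'I_n}) (F : {set edge n}) : Prop :=
  forall e, e \in F -> val e \subset W.

(* (W, F) is connected (vacuous for the empty graph and a single vertex). *)
Definition connected_sg n (W : {set 'I_n}) (F : {set edge n}) : Prop :=
  forall u w, u \in W -> w \in W -> connect (adjF F) u w.

Definition two_edge_connected n (W : {set 'I_n}) (F : {set edge n}) : Prop :=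
  subgraph W F /\ connected_sg W F /\
  (forall e, e \in F -> connected_sg W (F :\ e)).

Notation pt R n := {ffun edge n -> R}.

Definition chi (R : realFieldType) n (F : {set edge n}) : pt R n :=
  [ffun e => if e \in F then 1 else 0].

Definition TECSP (R : realFieldType) n (x : pt R n) : Prop :=
  exists lam : {ffun {set edge n} -> R},
    (forall F, 0 <= lam F) /\
    (forall F, lam F != 0 -> exists W, two_edge_connected W F) /\
    \sum_F lam F = 1 /\
    forall e, x e = \sum_F lam F * chi R F e.

Definition aff_indep (R : realFieldType) n k (p : 'I_k.+1 -> pt R n) : Prop :=
  forall c : 'I_k -> R,
    (forall e, \sum_(i < k) c i * (p (lift ord0 i) e - p ord0 e) = 0) ->
    forall i, c i = 0.

Definition has_affdim (R : realFieldType) n (P : pt R n -> Prop) (d : nat) : Prop :=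
  (exists p : 'I_d.+1 -> pt R n, (forall i, P (p i)) /\ aff_indep p) /\
  (forall k (p : 'I_k.+1 -> pt R n), (forall i, P (p i)) -> aff_indep p -> (k <= d)%N).

Definition defines_facet (R : realFieldType) n (P : pt R n -> Prop)
    (g : pt R n -> R) (b : R) : Prop :=
  (forall x, P x -> g x <= b) /\
  exists D : nat, has_affdim P D.+1 /\ has_affdim (fun x => P x /\ g x = b) D.

(* Main.v *)
(** Every edge [vu] of a bridgeless graph forces a second edge at [u], so the
    edges avoiding [v] cover the neighbours of [v]; counting the covered
    vertices gives validity of both inequalities.  For the facet property,
    neither hyperplane contains the origin, so it is enough that the incidence
    vectors of tight graphs span the whole space linearly, that is, that a
    functional [a] vanishing on them is zero.  Tight graphs are windmills
    (triangles through [v], otherwise disjoint) that miss one vertex [x];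
    attaching [x] through the edges [vx] and [xy] keeps tightness, whence
    [a(vx) + a(xy) = 0] for all [x], [y], and then [a = 0].  For odd [n] this
    handles [K_n - w1]; the edges at [w1] are settled by a windmill using the
    triangle [v w1 w2], by a square [v w2 w1 u], and by a [K_{2,3}] with parts
    [{v, w1}] and [{w2, u, t}]. *)
Require Import Defs.
From HB Require Import structures.
From mathcomp Require Import all_boot all_order all_algebra.
From mathcomp Require Import zify lra.
Import Order.TTheory GRing.Theory Num.Theory.
Set Implicit Arguments. Unset Strict Implicit. Unset Printing Implicit Defensive.
Local Open Scope ring_scope.

(** * Connectivity, gluing and vertex degrees in bridgeless graphs *)

Section TwoEdgeConnectedGraphs.
Variable n : nat.
Implicit Types (u v w x y z : 'I_n) (W : {set 'I_n}) (F : {set edge n}).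
Implicit Types (s : seq {set 'I_n}).

Definition tec F := exists W, two_edge_connected W F.

Definition connected_sgb W F :=
  [forall u in W, forall w in W, connect (adjF F) u w].

Lemma connected_sgP W F : reflect (connected_sg W F) (connected_sgb W F).
Proof.
apply: (iffP forall_inP) => [H u w uW wW|H u uW].
  by have /forall_inP/(_ w wW) := H u uW.
by apply/forall_inP => w; apply: H.
Qed.

(** A boolean form of [tec], because the matrix in [span_basis] selects edge sets by a boolean
    predicate. *)
Definition tecb F :=
  [exists W : {set 'I_n}, [&& [forall e in F, val e \subset W], connected_sgb W F
    & [forall e in F, connected_sgb W (F :\ e)]]].

Lemma tecP F : reflect (tec F) (tecb F).
Proof.
apply: (iffP existsP) => [[W /and3P[/forall_inP H1 /connected_sgP H2 /forall_inP H3]]|].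
  exists W; split; first exact: H1; split=> // e eF.
  by apply/connected_sgP/H3.
case=> W [H1 [H2 H3]]; exists W; apply/and3P; split.
- exact/forall_inP.
- exact/connected_sgP.
- by apply/forall_inP => e eF; apply/connected_sgP/H3.
Qed.

Lemma adjF_sym F u w : adjF F u w = adjF F w u.
Proof. by rewrite /adjF setUC. Qed.

Lemma connect_adjF_sym F u w : connect (adjF F) u w = connect (adjF F) w u.
Proof. by apply: sym_connect_sym => ? ?; apply: adjF_sym. Qed.

Lemma sub_adjF F F' u w : F \subset F' -> connect (adjF F) u w -> connect (adjF F') u w.
Proof.
move=> sFF'; apply: connect_sub => a b /existsP[e /andP[eF eab]].
by apply: connect1; apply/existsP; exists e; rewrite (subsetP sFF').
Qed.

Lemma connected_sg_root W F r :
  (forall w, w \in W -> connect (adjF F) r w) -> connected_sg W F.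
Proof.
move=> H u w uW wW; apply: (@connect_trans _ _ r); last exact: H.
by rewrite connect_adjF_sym; apply: H.
Qed.

Lemma connected_sgU W1 W2 F1 F2 r : r \in W1 -> r \in W2 ->
  connected_sg W1 F1 -> connected_sg W2 F2 -> connected_sg (W1 :|: W2) (F1 :|: F2).
Proof.
move=> r1 r2 c1 c2; apply: (@connected_sg_root _ _ r) => w /setUP[] wW.
  by apply: sub_adjF (c1 _ _ r1 wW); apply: subsetUl.
by apply: sub_adjF (c2 _ _ r2 wW); apply: subsetUr.
Qed.

Lemma connected_sg_sub W F F' : F \subset F' -> connected_sg W F -> connected_sg W F'.
Proof. by move=> sF c u w uW wW; apply: sub_adjF (c _ _ uW wW). Qed.

(** For [e] outside [F] the deletion changes nothing. Gluing relies on this case, because an edge of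
    a union may lie in only one of the pieces. *)
Lemma two_edge_connected_D1 W F e : two_edge_connected W F -> connected_sg W (F :\ e).
Proof.
case=> _ [c H]; have [/H//|eF] := boolP (e \in F).
by apply: connected_sg_sub c; rewrite subsetD1 subxx.
Qed.

(** Deleting [e] from the union deletes it from each piece; both pieces stay connected and still
    meet in [r]. The edge sets may overlap, as they do for the ear and the $K_{2,3}$ below. *)
Lemma two_edge_connectedU W1 W2 F1 F2 r : r \in W1 -> r \in W2 ->
  two_edge_connected W1 F1 -> two_edge_connected W2 F2 ->
  two_edge_connected (W1 :|: W2) (F1 :|: F2).
Proof.
move=> r1 r2 t1 t2; split; last split.
- case: t1 t2 => s1 _ [s2 _] e /setUP[/s1|/s2] se.
    by apply: subset_trans se _; apply: subsetUl.
  by apply: subset_trans se _; apply: subsetUr.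
- case: t1 t2 => _ [c1 _] [_ [c2 _]].
  exact: (connected_sgU r1 r2 c1 c2).
- move=> e _; rewrite setDUl.
  have := connected_sgU r1 r2 (@two_edge_connected_D1 _ _ e t1) (@two_edge_connected_D1 _ _ e t2).
  exact.
Qed.

(** Since [e] is not a bridge, some path avoiding [e] leads from [u] to the other end of [e]; its
    first edge is the required one. *)
Lemma deg_ge2 F e u : tec F -> e \in F -> u \in val e ->
  exists e', [/\ e' \in F, e' != e & u \in val e'].
Proof.
move=> [W [sW [_ c]]] eF ue.
have /cards2P[a [b [ab eab]]] := valP e.
have [w we uw] : exists2 w, w \in val e & u != w.
  move: ue; rewrite eab !inE => /orP[]/eqP->; [exists b | exists a] => //;
  by rewrite ?inE ?eqxx ?orbT // eq_sym.
have /connectP[[|x p] /=] := c e eF u w (subsetP (sW e eF) u ue) (subsetP (sW e eF) w we).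
  by move=> _ E; rewrite E eqxx in uw.
case/andP=> /existsP[e' /andP[]]; rewrite !inE => /andP[e'e e'F] /eqP e'u _ _.
by exists e'; split=> //; rewrite e'u !inE eqxx.
Qed.

Lemma edge_eqP (e e' : edge n) x y :
  x != y -> x \in val e -> y \in val e -> x \in val e' -> y \in val e' -> e = e'.
Proof.
move=> xy xe ye xe' ye'.
have H (d : edge n) : x \in val d -> y \in val d -> val d = [set x; y].
  move=> xd yd; apply/esym/eqP; rewrite eqEcard (eqP (valP d)) cards2 xy leqnn andbT.
  by rewrite subUset !sub1set xd.
by apply: val_inj; rewrite (H e) // (H e').
Qed.

Lemma card_cover (S : {set 'I_n}) (E : {set edge n}) :
  (forall u, u \in S -> exists2 e, e \in E & u \in val e) -> (#|S| <= 2 * #|E|)%N.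
Proof.
move=> H; have sS : S \subset \bigcup_(e in E) val e.
  by apply/subsetP => u /H[e eE ue]; apply/bigcupP; exists e.
apply: leq_trans (subset_leq_card sS) _.
have -> : (2 * #|E| = \sum_(e in E) #|val e|)%N.
  rewrite (eq_bigr (fun=> 2%N)) => [|e _]; last exact/eqP/(valP e).
  by rewrite sum_nat_const mulnC.
elim/big_rec2: _ => [|e A m _ le_mA]; first by rewrite cards0.
by rewrite cardsU (leq_trans (leq_subr _ _)) // leq_add2l.
Qed.

(** * Explicit graphs given by lists of vertex pairs: triangles and squares *)

(** Concrete graphs are written as lists of vertex sets, so that sums over their edges unfold term
    by term. Entries that do not have exactly two elements contribute no edge. *)
Definition edges_of s : {set edge n} := [set e | val e \in s].

Lemma eq_edges_of s1 s2 : s1 =i s2 -> edges_of s1 = edges_of s2.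
Proof. by move=> eq12; apply/setP => e; rewrite !inE eq12. Qed.

Lemma edges_of_cat s1 s2 : edges_of (s1 ++ s2) = edges_of s1 :|: edges_of s2.
Proof. by apply/setP => e; rewrite !inE mem_cat. Qed.

Lemma eq_set2 x y z w : ([set x; y] == [set z; w]) =
  (x == z) && (y == w) || (x == w) && (y == z).
Proof.
apply/eqP/idP => [E|/orP[]/andP[/eqP-> /eqP->]//]; last by rewrite setUC.
have H u : (u \in [set x; y]) = (u \in [set z; w]) by rewrite E.
have := H x; have := H y; have := H z; have := H w; rewrite !inE !eqxx ?orbT /=.
rewrite (eq_sym z x) (eq_sym z y) (eq_sym w x) (eq_sym w y).
by case: (x == z); case: (x == w); case: (y == z); case: (y == w).
Qed.

Lemma ex_edge (A : {set 'I_n}) : #|A| = 2%N -> exists e : edge n, val e = A.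
Proof. by move/eqP => c2; exists (exist (fun e : {set 'I_n} => #|e| == 2%N) A c2). Qed.

Lemma adjF_edges_ofD1 s (e : edge n) x y : x != y -> [set x; y] \in s ->
  [set x; y] != val e -> adjF (edges_of s :\ e) x y.
Proof.
move=> xy xys xye; have [|d dE] := @ex_edge [set x; y]; first by rewrite cards2 xy.
apply/existsP; exists d; rewrite !inE dE xys eqxx !andbT.
by apply: contraNneq xye => <-; rewrite dE.
Qed.

Lemma connected_sg_path F W x p :
  path (adjF F) x p -> W =i x :: p -> connected_sg W F.
Proof.
move=> xp eW; apply: (@connected_sg_root _ _ x) => w.
by rewrite eW => wp; apply: path_connect xp _ wp.
Qed.

(** Connectedness of the whole graph follows from that of a single edge deletion, so only deletions
    have to be examined; nonemptiness supplies one. *)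
Lemma two_edge_connectedI W s : (forall A : {set 'I_n}, A \in s -> A \subset W) ->
  edges_of s != set0 ->
  (forall e, e \in edges_of s -> connected_sg W (edges_of s :\ e)) ->
  two_edge_connected W (edges_of s).
Proof.
move=> sW /set0Pn[e eF] H; split; last split => //.
  by move=> e'; rewrite inE => /sW.
by apply: connected_sg_sub (H e eF); apply: subD1set.
Qed.

Lemma edges_of_neq0 s x y : x != y -> [set x; y] \in s -> edges_of s != set0.
Proof.
move=> xy xys; have [|d dE] := @ex_edge [set x; y]; first by rewrite cards2 xy.
by apply/set0Pn; exists d; rewrite inE dE.
Qed.

Lemma two_edge_connected_triangle x y z : uniq [:: x; y; z] ->
  two_edge_connected [set x; y; z] (edges_of [:: [set x; y]; [set x; z]; [set y; z]]).
Proof.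
rewrite /= !inE !negb_or andbT => /andP[/andP[xy xz] yz].
have [yx zx zy] : [/\ y != x, z != x & z != y] by split; rewrite eq_sym.
pose E := (negbTE xy, negbTE xz, negbTE yz, negbTE yx, negbTE zx, negbTE zy).
apply: two_edge_connectedI.
- by move=> u; rewrite !inE => /or3P[]/eqP->; rewrite subUset !sub1set !inE !eqxx ?orbT.
- by apply: (@edges_of_neq0 _ x y); rewrite ?inE ?eqxx.
- move=> e; rewrite !inE => /or3P[]/eqP eE.
  + apply: (@connected_sg_path _ _ x [:: z; y]) => [/=|w].
      2: by rewrite !inE -!orbA; do !bool_congr.
    by rewrite !adjF_edges_ofD1 ?eE ?inE ?eq_set2 ?eqxx ?E ?orbT.
  + apply: (@connected_sg_path _ _ x [:: y; z]) => [/=|w].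
      2: by rewrite !inE -!orbA; do !bool_congr.
    by rewrite !adjF_edges_ofD1 ?eE ?inE ?eq_set2 ?eqxx ?E ?orbT.
  + apply: (@connected_sg_path _ _ y [:: x; z]) => [/=|w].
      2: by rewrite !inE -!orbA; do !bool_congr.
    by rewrite !adjF_edges_ofD1 ?eE ?inE ?eq_set2 ?eqxx ?E ?orbT.
Qed.

Lemma two_edge_connected_square x y z t : uniq [:: x; y; z; t] ->
  two_edge_connected [set x; y; z; t]
    (edges_of [:: [set x; y]; [set y; z]; [set z; t]; [set t; x]]).
Proof.
rewrite /= !inE !negb_or !andbT -!andbA => /and5P[xy xz xt yz /andP[yt zt]].
have [[yx zx tx] [zy ty tz]] : [/\ y != x, z != x & t != x] /\ [/\ z != y, t != y & t != z].
  by do 2!split; rewrite eq_sym.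
pose E := (negbTE xy, negbTE xz, negbTE xt, negbTE yz, negbTE yt, negbTE zt,
  (negbTE yx, negbTE zx, negbTE tx, negbTE zy, negbTE ty, negbTE tz)).
apply: two_edge_connectedI.
- by move=> u; rewrite !inE => /or4P[]/eqP->; rewrite subUset !sub1set !inE !eqxx ?orbT.
- by apply: (@edges_of_neq0 _ x y); rewrite ?inE ?eqxx.
- move=> e; rewrite !inE => /or4P[]/eqP eE.
  + apply: (@connected_sg_path _ _ y [:: z; t; x]) => [/=|w].
      2: by rewrite !inE -!orbA; do !bool_congr.
    by rewrite !adjF_edges_ofD1 ?eE ?inE ?eq_set2 ?eqxx ?E ?orbT.
  + apply: (@connected_sg_path _ _ z [:: t; x; y]) => [/=|w].
      2: by rewrite !inE -!orbA; do !bool_congr.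
    by rewrite !adjF_edges_ofD1 ?eE ?inE ?eq_set2 ?eqxx ?E ?orbT.
  + apply: (@connected_sg_path _ _ t [:: x; y; z]) => [/=|w].
      2: by rewrite !inE -!orbA; do !bool_congr.
    by rewrite !adjF_edges_ofD1 ?eE ?inE ?eq_set2 ?eqxx ?E ?orbT.
  + apply: (@connected_sg_path _ _ x [:: y; z; t]) => [/=|w].
      2: by rewrite !inE -!orbA; do !bool_congr.
    by rewrite !adjF_edges_ofD1 ?eE ?inE ?eq_set2 ?eqxx ?E ?orbT.
Qed.

(** * Windmills and sums over them *)

(** The friendship graph with centre [v]: consecutive entries of [p] are paired into triangles
    through [v]. An unpaired last entry is ignored, hence the parity hypotheses below. *)
Fixpoint windmill v (p : seq 'I_n) : seq {set 'I_n} :=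
  if p is x :: y :: q then
    [set v; x] :: [set v; y] :: [set x; y] :: windmill v q
  else [::].

Lemma seq_pair_ind (T : Type) (P : seq T -> Prop) : P [::] ->
  (forall (x y : T) p, ~~ odd (size p) -> P p -> P (x :: y :: p)) ->
  forall p, ~~ odd (size p) -> P p.
Proof.
move=> P0 P2 p; have [m] := ubnP (size p); elim: m p => // m IH [|x [|y p]] //=.
by rewrite negbK => sp op; apply: (P2) => //; apply: IH => //; lia.
Qed.

(** The triangles are glued one after another at [v], starting from the single vertex [v]. *)
Lemma two_edge_connected_windmill v (p : seq 'I_n) : ~~ odd (size p) -> uniq (v :: p) ->
  two_edge_connected [set w in v :: p] (edges_of (windmill v p)).
Proof.
move: p; apply: seq_pair_ind => [_|x y p op IH].
  split; last split.
  - by move=> e; rewrite inE.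
  - by move=> u w; rewrite !inE => /eqP-> /eqP->; apply: connect0.
  - by move=> e; rewrite inE.
move=> /= U; have U3 : uniq [:: v; x; y].
  by move: U; rewrite /= !inE !negb_or; case/and3P=> /and3P[-> -> _] /andP[-> _].
have Up : uniq (v :: p).
  by move: U; rewrite /= !inE !negb_or; case/and3P=> /and3P[_ _ ->] _ /andP[_].
have -> : [set w in [:: v, x, y & p]] = [set v; x; y] :|: [set w in v :: p].
  by apply/setP => w; rewrite !inE; case: (w == v); case: (w == x); case: (w == y).
rewrite -[edges_of _]/(edges_of ([:: [set v; x]; [set v; y]; [set x; y]] ++ windmill v p)).
rewrite edges_of_cat; apply: (@two_edge_connectedU _ _ _ _ v); rewrite ?inE ?eqxx //.
  exact: two_edge_connected_triangle.
exact: IH.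
Qed.

Lemma windmill_sub v p (e : {set 'I_n}) : e \in windmill v p -> e \subset v :: p.
Proof.
have [m] := ubnP (size p); elim: m p => // m IH [|x [|y p]] //= sp.
have sub2 a b : a \in [:: v, x, y & p] -> b \in [:: v, x, y & p] ->
    [set a; b] \subset [:: v, x, y & p].
  by move=> ha hb; apply/subsetP => w; rewrite inE => /orP[]/set1P->.
rewrite !inE => /or4P[/eqP->|/eqP->|/eqP->|ew]; try by apply: sub2; rewrite !inE eqxx ?orbT.
have /subset_trans -> // : e \subset v :: p by apply: IH => //; lia.
by apply/subsetP => w; rewrite !inE => /orP[->|->]; rewrite ?orbT.
Qed.

Lemma uniq_cat_windmill v p s : uniq s -> {in s, forall e : {set 'I_n}, ~~ (e \subset v :: p)} ->
  uniq (windmill v p) -> uniq (s ++ windmill v p).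
Proof.
move=> us H uw; rewrite cat_uniq us uw andbT; apply/hasPn => e /windmill_sub.
by apply: contraL => /H.
Qed.

Lemma set2_nsub x y (A : seq 'I_n) : (x \notin A) || (y \notin A) ->
  ~~ ([set x; y] \subset A).
Proof. by rewrite -negb_and; apply: contra => /subsetP sA; rewrite !sA ?inE ?eqxx ?orbT. Qed.

Lemma uniq_windmill v p : uniq (v :: p) -> uniq (windmill v p).
Proof.
have [m] := ubnP (size p); elim: m p => // m IH [|x [|y p]] // sp.
rewrite [uniq _]/= !inE !negb_or -!andbA => /and5P[vx vy vp xy /and3P[xp yp up]].
have [yx xv yv] : [/\ y != x, x != v & y != v] by split; rewrite eq_sym.
rewrite -[windmill _ _]/([:: [set v; x]; [set v; y]; [set x; y]] ++ windmill v p).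
apply: uniq_cat_windmill.
- by rewrite /= !inE !eq_set2 !eqxx (negbTE vx) (negbTE vy) (negbTE xy) (negbTE yx).
- by move=> e; rewrite !inE => /or3P[]/eqP->; apply: set2_nsub;
    rewrite !inE !negb_or ?xv ?yv ?xp ?yp ?orbT.
- by apply: IH; [move: sp => /=; lia | rewrite /= vp up].
Qed.

Lemma windmill_card2 v p : uniq (v :: p) -> {in windmill v p, forall e : {set 'I_n}, #|e| = 2%N}.
Proof.
have [m] := ubnP (size p); elim: m p => // m IH [|x [|y p]] // sp.
rewrite [uniq _]/= !inE !negb_or -!andbA => /and5P[vx vy vp xy /and3P[xp yp up]] e.
rewrite !inE => /or4P[/eqP->|/eqP->|/eqP->|]; rewrite ?cards2 ?vx ?vy ?xy //.
by apply: IH; [move: sp => /=; lia | rewrite /= vp up].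
Qed.

(** When no entry repeats and each is a genuine edge, [val] maps [edges_of s] bijectively onto the
    entries of [s]. *)
Lemma sum_edges_of (V : zmodType) (a : {set 'I_n} -> V) s : uniq s ->
  {in s, forall e : {set 'I_n}, #|e| = 2%N} ->
  \sum_(e in edges_of s) a (val e) = \sum_(e <- s) a e.
Proof.
move=> us c2; rewrite (big_uniq _ us) /=.
rewrite [RHS](eq_bigl (fun e => e \in [set val e | e in edges_of s])) => [|A].
  by rewrite big_imset //= => ? ? _ _; apply: val_inj.
apply/idP/imsetP => [As|[e]]; last by rewrite inE => es ->.
have [d dE] := ex_edge (c2 A As).
by exists d; rewrite ?inE dE.
Qed.

Lemma sum_windmill (V : zmodType) (a : {set 'I_n} -> V) (k : V) v p :
  ~~ odd (size p) -> uniq p ->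
  {in p &, forall x y, x != y -> a [set v; x] + a [set v; y] + a [set x; y] = k} ->
  \sum_(e <- windmill v p) a e = k *+ (size p)./2.
Proof.
move: p; apply: seq_pair_ind => [|x y p op IH]; first by rewrite big_nil.
rewrite /= !inE negb_or -!andbA => /and4P[xy xp yp up] H.
rewrite !big_cons IH // => [|u w up' wp]; last by apply: H; rewrite !inE (up', wp) !orbT.
by rewrite mulrS !addrA H // !inE eqxx ?orbT.
Qed.

End TwoEdgeConnectedGraphs.

(** * Linear algebra: a sufficient condition for a facet *)

Section FacetCriterion.
Variables (R : realFieldType) (n : nat).
Implicit Types (F : {set edge n}) (x : pt R n) (a c : edge n -> R).

Lemma sum_chi a F : \sum_e a e * chi R F e = \sum_(e in F) a e.
Proof.
rewrite [RHS]big_mkcond; apply: eq_bigr => e _; rewrite ffunE.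
by case: ifP; rewrite ?mulr1 ?mulr0.
Qed.

Lemma TECSP_chi F : tec F -> TECSP (chi R F).
Proof.
move=> tF; exists [ffun F' => (F' == F)%:R]; split; last split; last split.
- by move=> F'; rewrite ffunE ler0n.
- by move=> F'; rewrite ffunE; case: (F' =P F) => [-> _|]; [exact: tF | rewrite eqxx].
- by rewrite (bigD1 F) //= ffunE eqxx big1 ?addr0 // => F' /negbTE F'F; rewrite ffunE F'F.
- move=> e; rewrite (bigD1 F) //= [X in X * _]ffunE eqxx mul1r big1 ?addr0 // => F' /negbTE F'F.
  by rewrite ffunE F'F mul0r.
Qed.

Lemma TECSP_linear_le c b : (forall F, tec F -> \sum_(e in F) c e <= b) ->
  forall x, TECSP x -> \sum_e c e * x e <= b.
Proof.
move=> valid x [lam [lam0 [lamT [lam1 xE]]]].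
have -> : \sum_e c e * x e = \sum_F lam F * \sum_(e in F) c e.
  under eq_bigr do rewrite xE mulr_sumr.
  rewrite exchange_big /=; apply: eq_bigr => F _; rewrite -sum_chi mulr_sumr.
  by apply: eq_bigr => e _; rewrite mulrCA.
rewrite -[b]mul1r -lam1 mulr_suml; apply: ler_sum => F _.
have [->|lF] := eqVneq (lam F) 0; first by rewrite !mul0r.
by rewrite ler_wpM2l // valid //; apply: lamT.
Qed.

(** The vectors form the rows of a matrix with one column per edge, whose rank is at most the number
    of columns. This gives the upper bounds for both dimensions. *)
Lemma linear_indep_leq k (p : 'I_k -> pt R n) :
  (forall d : 'I_k -> R, (forall e, \sum_i d i * p i e = 0) -> forall i, d i = 0) ->
  (k <= #|{: edge n}|)%N.
Proof.
move=> indep; pose A := \matrix_(i < k, j < #|{: edge n}|) p i (enum_val j).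
suff : row_free A by rewrite -row_leq_rank => /leq_trans; apply; apply: rank_leq_col.
apply: inj_row_free => d dA; apply/rowP => i; rewrite mxE.
apply: (indep (fun i => d 0 i)) => e.
have /rowP/(_ (enum_rank e)) := dA; rewrite !mxE => E0; rewrite -[RHS]E0.
by apply: eq_bigr => j _; rewrite mxE enum_rankK.
Qed.

(** Duality: if only the zero functional vanishes on the incidence vectors from [T], these span the
    whole space and a basis can be selected among them. *)
Lemma span_basis (T : pred {set edge n}) :
  (forall a, (forall F, T F -> \sum_(e in F) a e = 0) -> forall e, a e = 0) ->
  exists B : 'I_#|{: edge n}| -> {set edge n}, (forall i, T (B i)) /\
    forall d : 'I_#|{: edge n}| -> R, (forall e, \sum_i d i * chi R (B i) e = 0) ->
      forall i, d i = 0.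
Proof.
move=> span; set N := #|_|.
(* Rows range over all edge sets; those outside [T] are zero rows, which an invertible selection
   cannot contain. *)
pose A := \matrix_(i < #|{: {set edge n}}|, j < N)
  if T (enum_val i) then chi R (enum_val i) (enum_val j) else 0.
(* A vector in the left kernel of the transpose is a functional vanishing on [T]. *)
have Afull : row_full A.
  rewrite /row_full -mxrank_tr -/(row_free A^T).
  apply: inj_row_free => a aA; apply/rowP => j; rewrite mxE.
  rewrite -[j]enum_valK; apply: (span (fun e => a 0 (enum_rank e))) => F TF.
  have /rowP/(_ (enum_rank F)) := aA; rewrite !mxE => E0; rewrite -[RHS]E0.
  rewrite -sum_chi (reindex _ (onW_bij _ (enum_val_bij _))) /=.
  by apply: eq_bigr => i _; rewrite !mxE !enum_rankK TF enum_valK.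
pose f := fullrankfun Afull.
have fA : rowsub f A \in unitmx by rewrite -row_full_unit; apply: fullrowsub_full.
have Tf i : T (enum_val (f i)).
  apply: contraT => nT; have : row i (rowsub f A) = 0.
    by apply/rowP => j; rewrite !mxE (negbTE nT).
  move: fA; rewrite -row_free_unit => /row_free_inj inj; rewrite rowE -[RHS](mul0mx _ (rowsub f A)).
  by move/inj/rowP/(_ i)/eqP; rewrite !mxE !eqxx oner_eq0.
exists (fun i => enum_val (f i)); split=> // d dE i.
move: fA; rewrite -row_free_unit => /row_free_inj inj.
have /inj/rowP/(_ i) : (\row_i d i) *m rowsub f A = 0 *m rowsub f A.
  rewrite mul0mx; apply/rowP => j; rewrite !mxE -[RHS](dE (enum_val j)).
  by apply: eq_bigr => l _; rewrite !mxE Tf.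
by rewrite !mxE.
Qed.

Lemma tec0 : tec (set0 : {set edge n}).
Proof.
by exists set0; split; last split; [move=> e; rewrite inE | move=> u w; rewrite inE
  | move=> e; rewrite inE].
Qed.

(* As [b != 0], the hyperplane misses the origin, so linear independence of the
   tight vectors is the same as affine independence, and the empty graph
   completes them to an affine basis of the whole space. *)
Lemma facet_criterion c b (g : pt R n -> R) :
  (0 < #|{: edge n}|)%N -> b != 0 -> (forall x, g x = \sum_e c e * x e) ->
  (forall F, tec F -> \sum_(e in F) c e <= b) ->
  (forall a, (forall F, tec F -> \sum_(e in F) c e = b -> \sum_(e in F) a e = 0) ->
     forall e, a e = 0) ->
  defines_facet (@TECSP R n) g b.
Proof.
move=> N0 b0 gE valid span; split=> [x|]; first by rewrite gE; apply: TECSP_linear_le.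
have [B [BT Bindep]] : exists B : 'I_#|{: edge n}| -> {set edge n},
    (forall i, tec (B i) /\ \sum_(e in B i) c e = b) /\
    forall d : 'I_#|{: edge n}| -> R, (forall e, \sum_i d i * chi R (B i) e = 0) ->
      forall i, d i = 0.
  have [|B [BT Bi]] := @span_basis (fun F => tecb F && (\sum_(e in F) c e == b)).
    move=> a aT; apply: span => F tF tight; apply: aT.
    by rewrite tight eqxx andbT; apply/tecP.
  by exists B; split=> // i; have /andP[/tecP ? /eqP] := BT i.
have leN k (p : 'I_k -> pt R n) := @linear_indep_leq k p.
(* Here [D.+1] is the number of edges, the dimension of the whole polytope; the tight face has
   dimension [D]. *)
move: B BT Bindep leN; case: #|_| N0 => // D _ B BT Bindep leN.
exists D; split; split.
- exists (fun i => if unlift ord0 i is Some j then chi R (B j) else chi R set0).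
  split=> [i|d dE i].
    by case: unlift => [j|]; apply: TECSP_chi; [case: (BT j) | exact: tec0].
  apply: Bindep => e; rewrite -[RHS](dE e); apply: eq_bigr => j _.
  by rewrite liftK unlift_none [chi R set0 e]ffunE inE subr0.
- move=> k p _ pi; apply: (leN _ (fun i => [ffun e => p (lift ord0 i) e - p ord0 e])).
  move=> d dE; apply: pi => e; rewrite -[RHS](dE e).
  by apply: eq_bigr => i _; rewrite ffunE.
- exists (fun i => chi R (B i)); split=> [i|d dE i].
    by have [tB cB] := BT i; split; [exact: TECSP_chi | rewrite gE sum_chi].
  (* The base vector receives minus the sum of the other coefficients, which turns the affine
     relation into a linear one. *)
  pose d' i := if unlift ord0 i is Some j then d j else - \sum_j d j.
  have -> : d i = d' (lift ord0 i) by rewrite /d' liftK.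
  apply: Bindep => e; rewrite big_ord_recl /= {1}/d' unlift_none -[RHS](dE e).
  rewrite mulNr mulr_suml addrC -sumrB; apply: eq_bigr => j _.
  by rewrite /d' liftK mulrBr.
- move=> k p pP pi; rewrite -ltnS; apply: (leN _ p) => d dE.
  (* Every point lies on the hyperplane, so applying [c] to the relation gives [b] times the sum of
     the coefficients; since [b != 0], that sum vanishes. *)
  have d0 : \sum_i d i = 0.
    have : \sum_e c e * (\sum_i d i * p i e) = 0.
      by apply: big1 => e _; rewrite dE mulr0.
    under eq_bigr do rewrite mulr_sumr; rewrite exchange_big /=.
    under eq_bigr => i _.
      under eq_bigr do rewrite mulrCA.
      rewrite -mulr_sumr -gE; have [_ ->] := pP i; over.
    by rewrite -mulr_suml => /eqP; rewrite mulf_eq0 (negbTE b0) orbF => /eqP.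
  have dl : forall i, d (lift ord0 i) = 0.
    apply: (pi (fun i => d (lift ord0 i))) => e.
    under eq_bigr do rewrite mulrBr; rewrite sumrB -mulr_suml.
    have /eqP := dE e; rewrite big_ord_recl /= addr_eq0 => /eqP E1.
    move/eqP: d0; rewrite big_ord_recl addr_eq0 => /eqP E2.
    by rewrite -[X in X - _]opprK -E1 E2 mulNr opprK subrr.
  move=> i; case: (unliftP ord0 i) => [j ->|->]; first exact: dl.
  by move: d0; rewrite big_ord_recl /= big1 ?addr0.
Qed.

End FacetCriterion.

(** * Building blocks for tight graphs *)

Section TightGraphs.
Variable n : nat.
Implicit Types (v w x y z : 'I_n) (p : seq 'I_n) (s : seq {set 'I_n}).

(** The first two conditions let [sum_edges_of] replace a sum over the edge set by a sum over the
    list. *)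
Definition tec_list s :=
  [/\ uniq s, {in s, forall A : {set 'I_n}, #|A| = 2%N} & tec (edges_of s)].

Lemma tec_list_cat_windmill v p s : ~~ odd (size p) -> uniq (v :: p) ->
  uniq s -> {in s, forall A : {set 'I_n}, #|A| = 2%N /\ ~~ (A \subset v :: p)} ->
  (exists2 W : {set 'I_n}, v \in W & two_edge_connected W (edges_of s)) ->
  tec_list (s ++ windmill v p).
Proof.
move=> ev up us sP [W vW tW]; split.
- by apply: uniq_cat_windmill => // [A /sP[]|]; last exact: uniq_windmill.
- by move=> A; rewrite mem_cat => /orP[/sP[]|/windmill_card2] //; apply.
- rewrite edges_of_cat; exists (W :|: [set w in v :: p]).
  apply: (two_edge_connectedU vW _ tW); first by rewrite inE mem_head.
  exact: two_edge_connected_windmill.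
Qed.

Lemma tec_list_windmill v p : ~~ odd (size p) -> uniq (v :: p) ->
  tec_list (windmill v p).
Proof.
move=> ev up; split; [exact: uniq_windmill | exact: windmill_card2 |].
by exists [set w in v :: p]; apply: two_edge_connected_windmill.
Qed.

(** The triangle on [v], [x], [y] overlaps the windmill in the edge joining [v] and [y], so only the
    two edges at [x] are new. *)
Lemma tec_list_ear v x y z p : ~~ odd (size p) -> uniq [:: v, x, y, z & p] ->
  tec_list ([:: [set v; x]; [set x; y]] ++ windmill v [:: y, z & p]).
Proof.
move=> ev U; have Uw : uniq [:: v, y, z & p].
  by move: U; rewrite /= !inE !negb_or; case/and3P=> /and4P[_ -> -> ->].
have U3 : uniq [:: v; x; y].
  by move: U; rewrite /= !inE !negb_or; case/and3P=> /and4P[-> -> _ _] /and3P[-> _ _].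
have evz : ~~ odd (size [:: y, z & p]) by rewrite /= negbK.
have [uw cw [W tW]] := tec_list_windmill evz Uw.
have [vx vy xy xp]: [/\ v != x, v != y, x != y & x \notin [:: v, y, z & p]].
  move: U; rewrite /= !inE !negb_or (eq_sym x v).
  by case/and3P=> /and4P[-> -> _ _] /and3P[-> -> ->].
split.
- apply: uniq_cat_windmill => //.
    by rewrite /= !inE eq_set2 eqxx (negbTE vx) (negbTE vy).
  by move=> A; rewrite !inE => /orP[]/eqP->; apply: set2_nsub; rewrite xp ?orbT.
- move=> A; rewrite mem_cat !inE => /orP[/orP[]/eqP->|/cw//];
  by rewrite cards2 ?vx ?xy.
- exists ([set v; x; y] :|: [set w in [:: v, y, z & p]]).
  (* Listing the shared edge twice leaves the edge set unchanged and displays it as triangle plus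
     windmill. *)
  rewrite (@eq_edges_of _ _ ([:: [set v; x]; [set v; y]; [set x; y]] ++ windmill v [:: y, z & p])).
    rewrite edges_of_cat; apply: (@two_edge_connectedU _ _ _ _ _ v); rewrite ?inE ?eqxx //.
      exact: two_edge_connected_triangle.
    exact: two_edge_connected_windmill.
  move=> A; rewrite !inE.
  by case: (A == [set v; x]); case: (A == [set v; y]); case: (A == [set x; y]).
Qed.

Lemma tec_list_square v x y z p : ~~ odd (size p) -> uniq [:: v, x, y, z & p] ->
  tec_list ([:: [set v; x]; [set x; y]; [set y; z]; [set z; v]] ++ windmill v p).
Proof.
move=> ev; rewrite [uniq _]/= !inE !negb_or -!andbA.
case/and5P=> vx vy vz vp /and5P[xy xz xp yz /and3P[yp zp up]].
have U4 : uniq [:: v; x; y; z] by rewrite /= !inE !negb_or vx vy vz xy xz yz.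
have sym (a b : 'I_n) : a != b -> (b == a) = false by rewrite eq_sym => /negbTE.
pose E := (sym _ _ vx, sym _ _ vy, sym _ _ vz, sym _ _ xy, sym _ _ xz, sym _ _ yz,
  (negbTE vx, negbTE vy, negbTE vz, negbTE xy, negbTE xz, negbTE yz)).
apply: tec_list_cat_windmill => //.
- by rewrite /= vp.
- by rewrite /= !inE !eq_set2 ?eqxx ?E.
- by move=> A; rewrite !inE => /or4P[]/eqP->; split; rewrite ?cards2 ?E //;
    apply: set2_nsub; rewrite !inE !negb_or ?E ?(negbTE xp) ?(negbTE yp) ?(negbTE zp) ?orbT.
- by exists [set v; x; y; z]; [rewrite !inE eqxx | exact: two_edge_connected_square].
Qed.

(** The $K_{2,3}$ with parts [{v, y}] and [{x, z, t}] is the union of two squares that share the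
    path from [v] through [x] to [y]. *)
Lemma tec_list_K23 v x y z t p : ~~ odd (size p) -> uniq [:: v, x, y, z, t & p] ->
  tec_list ([:: [set v; x]; [set x; y]; [set y; z]; [set z; v]; [set y; t]; [set t; v]]
    ++ windmill v p).
Proof.
move=> ev; rewrite [uniq _]/= !inE !negb_or -!andbA.
case/and5P=> vx vy vz vt /and5P[vp xy xz xt /and5P[xp yz yt yp /and4P[zt zp tp up]]].
have sym (a b : 'I_n) : a != b -> (b == a) = false by rewrite eq_sym => /negbTE.
pose E := (sym _ _ vx, sym _ _ vy, sym _ _ vz, sym _ _ xy, sym _ _ xz, sym _ _ yz,
  (negbTE vx, negbTE vy, negbTE vz, negbTE xy, negbTE xz, negbTE yz),
  (negbTE vt, negbTE xt, negbTE yt, negbTE zt),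
  (sym _ _ vt, sym _ _ xt, sym _ _ yt, sym _ _ zt)).
have U4 : uniq [:: v; x; y; z] by rewrite /= !inE ?E.
have U4' : uniq [:: v; x; y; t] by rewrite /= !inE ?E.
apply: tec_list_cat_windmill => //.
- by rewrite /= vp.
- by rewrite /= !inE !eq_set2 ?eqxx ?E.
- move=> A; rewrite !inE => AE; suff [a [b [-> ab nab]]] : exists a b, [/\ A = [set a; b], a != b
    & (a \notin v :: p) || (b \notin v :: p)] by rewrite cards2 ab; split=> //; apply: set2_nsub.
  by case/or4P: AE => [/eqP->|/eqP->|/eqP->|/or3P[]/eqP->];
    (do 2 eexists; split; first reflexivity);
    rewrite ?inE ?negb_or ?E ?(negbTE xp) ?(negbTE yp) ?(negbTE zp) ?(negbTE tp) ?orbT.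
- exists ([set v; x; y; z] :|: [set v; x; y; t]); first by rewrite !inE eqxx.
  rewrite (@eq_edges_of _ _ ([:: [set v; x]; [set x; y]; [set y; z]; [set z; v]] ++
    [:: [set v; x]; [set x; y]; [set y; t]; [set t; v]])); last first.
    move=> A; rewrite !inE; case: (A == [set v; x]); rewrite ?orbT //.
    by case: (A == [set x; y]); rewrite ?orbT.
  rewrite edges_of_cat; apply: (@two_edge_connectedU _ _ _ _ _ v); rewrite ?inE ?eqxx //;
  exact: two_edge_connected_square.
Qed.

Lemma completion (L U : seq 'I_n) : uniq L -> uniq U -> {subset L <= U} ->
  exists p : seq 'I_n, perm_eq (L ++ p) U.
Proof.
move=> uL uU sLU; exists [seq t <- U | t \notin L]; apply: uniq_perm => //.
  rewrite cat_uniq uL filter_uniq // andbT; apply/hasPn => t.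
  by rewrite mem_filter => /andP[].
by move=> t; rewrite mem_cat mem_filter; case: (boolP (t \in L)) => //= /sLU.
Qed.

Lemma windmills_span (R : realFieldType) (a : {set 'I_n} -> R) v (U : seq 'I_n) :
  uniq U -> odd (size U) -> (3 <= size U)%N ->
  (forall x p, perm_eq (x :: p) U -> \sum_(A <- windmill v p) a A = 0) ->
  (forall x y z p, perm_eq [:: x, y, z & p] U ->
    \sum_(A <- [:: [set v; x]; [set x; y]] ++ windmill v [:: y, z & p]) a A = 0) ->
  {in U, forall x, a [set v; x] = 0} /\
  {in U &, forall x y, x != y -> a [set x; y] = 0}.
Proof.
move=> uU oU U3 wm0 ear0.
(* The ear graph and its windmill differ in the two edges at [x]. A vertex [z] to pair with [y]
   exists because [U] has at least three elements. *)
have axy x y : x \in U -> y \in U -> x != y -> a [set v; x] + a [set x; y] = 0.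
  move=> xU yU xy.
  have [||[|z p] pU] := @completion [:: x; y] U _ uU.
  - by rewrite /= inE xy.
  - by move=> u; rewrite !inE => /orP[]/eqP->.
  - by move: U3; rewrite -(perm_size pU).
  have := ear0 x y z p pU; rewrite big_cat (wm0 x [:: y, z & p]) //= addr0.
  by rewrite !big_cons big_nil addr0.
(* Exchanging [x] and [y] in [axy] keeps [a [set x; y]], so [a [set v; x]] does not depend on
   [x]. *)
have a_eq x y : x \in U -> y \in U -> a [set v; x] = a [set v; y].
  move=> xU yU; have [->//|xy] := eqVneq x y.
  have E1 := axy x y xU yU xy; have := axy y x yU xU.
  by rewrite eq_sym (setUC [set y]) => /(_ xy) E2; apply: (addIr (a [set x; y])); rewrite E1 E2.
have a0 x : x \in U -> a [set v; x] = 0.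
  move=> xU; have [|u|p /= pU] := @completion [:: x] U _ uU; first by [].
    by rewrite inE => /eqP->.
  have := wm0 x p pU; have sp := perm_size pU; have up : uniq (x :: p) by rewrite (perm_uniq pU).
  have sub u : u \in p -> u \in U by rewrite -(perm_mem pU) inE orbC => ->.
  (* By [axy] two edges of each triangle cancel, so every triangle has the common value [a
     [set v; x]]. There is at least one triangle, so a vanishing total forces this value to be
     zero. *)
  rewrite (@sum_windmill _ _ _ (a [set v; x])).
  - move/eqP; rewrite mulrn_eq0 => /orP[|/eqP//].
    by move: sp => /= sp; lia.
  - by move: oU; rewrite -sp.
  - by case/andP: up.
  - move=> u w /sub uU' /sub wU uw; rewrite addrAC axy // add0r; exact: a_eq.
split=> // x y xU yU xy; have := axy x y xU yU xy.
by rewrite a0 // add0r.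
Qed.

End TightGraphs.

(** * Validity of the two inequalities *)

Section Validity.
Variable n : nat.
Implicit Types (u v w : 'I_n) (e f h : edge n) (E F : {set edge n}).

Definition neighbours v E := [set u | (u != v) && [exists e in E, u \in val e]].

(** Distinct edges at [v] have distinct other ends. *)
Lemma card_star v E : {in E, forall e, v \in val e} -> (#|E| <= #|neighbours v E|)%N.
Proof.
move=> vE; rewrite -(card_imset _ (@val_inj _ _ (edge n))).
apply: leq_trans (leq_imset_card (fun u => [set v; u]) _).
apply: subset_leq_card; apply/subsetP => _ /imsetP[e eE ->].
have /cards2P[x [y [xy exy]]] := valP e; have ve := vE e eE.
have [u uv eu] : exists2 u, u != v & val e = [set v; u].
  move: ve; rewrite exy !inE => /orP[]/eqP->; [exists y => //; by rewrite eq_sym|].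
  by exists x; rewrite // setUC.
apply/imsetP; exists u; rewrite // inE uv; apply/existsP; exists e.
by rewrite eE eu !inE eqxx orbT.
Qed.

(** The second edge at [u] cannot contain [v], since only one edge joins [u] and [v]. *)
Lemma neighboursP v F E u : tec F -> E \subset F -> {in E, forall e, v \in val e} ->
  u \in neighbours v E ->
  [/\ u != v, exists2 e, e \in E & val e = [set v; u]
    & exists2 e', e' \in F & (u \in val e') && (v \notin val e')].
Proof.
move=> tF sEF vE; rewrite inE => /andP[uv /existsP[e /andP[eE ue]]].
have ve := vE e eE.
have [e' [e'F e'e ue']] := deg_ge2 tF (subsetP sEF e eE) ue.
split=> //.
  exists e => //; apply/esym/eqP; rewrite eqEcard subUset !sub1set ue ve.
  by rewrite (eqP (valP e)) cards2 eq_sym uv.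
exists e' => //; rewrite ue'; apply: contraNN e'e => ve'.
by apply/eqP; apply: (edge_eqP uv).
Qed.

(** With $d$ edges at [v] and $k$ edges avoiding it, covering gives $d\le 2k$, and $d\le n-1=2m+1$.
    Adding yields $2d\le 2k+2m+1$, and parity removes the 1. *)
Lemma even_valid v F m : tec F -> n = (2 * m).+2 ->
  (#|[set e in F | v \in val e]| <= #|[set e in F | v \notin val e]| + m)%N.
Proof.
move=> tF nE; set E := [set e in F | v \in val e].
have vE : {in E, forall e, v \in val e} by move=> e; rewrite inE => /andP[].
have sEF : E \subset F by apply/subsetP => e; rewrite inE => /andP[].
have H1 := card_star vE.
have H2 : (#|neighbours v E| <= 2 * #|[set e in F | v \notin val e]|)%N.
  apply: card_cover => u /(neighboursP tF sEF vE)[_ _ [e' e'F /andP[ue' ve']]].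
  by exists e'; rewrite // inE e'F.
have H3 : (#|neighbours v E| <= n.-1)%N.
  have <- : #|[set~ v]| = n.-1 by rewrite cardsC1 card_ord.
  by apply: subset_leq_card; apply/subsetP => u; rewrite !inE => /andP[].
lia.
Qed.

(** The averaging of the even case again: without [f], the vertex [w1] is no neighbour, so at most
    $n-2=2m+1$ remain. It is left to bound them by twice the edges counted on the right, although
    [h] is not counted. *)
Lemma odd_valid v w1 w2 h f F m : tec F -> n = (2 * m).+3 ->
  v \notin val h -> val h = [set w1; w2] -> val f = [set v; w1] ->
  (#|[set e in F | (v \in val e) && (e != f)]|
    <= #|[set e in F | (v \notin val e) && (e != h)]| + (f \in F) + m)%N.
Proof.
move=> tF nE vh hE fE; set E := [set e in F | _]; set E' := [set e in F | _ && (e != h)].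
have w12 : w1 != w2 by have := eqP (valP h); rewrite hE cards2; case: eqP.
have vw1 : v != w1 by have := eqP (valP f); rewrite fE cards2; case: eqP.
have vE : {in E, forall e, v \in val e} by move=> e; rewrite inE => /and3P[].
have sEF : E \subset F by apply/subsetP => e; rewrite inE => /andP[].
have H1 := card_star vE.
have w1N : w1 \notin neighbours v E.
  apply/negP => /(neighboursP tF sEF vE)[_ [e eE ev] _].
  by move: eE; rewrite inE -(inj_eq val_inj) ev fE eqxx !andbF.
have H3 : (#|neighbours v E| <= n.-2)%N.
  have c2 : #|[set v; w1]| = 2%N by rewrite cards2 vw1.
  have <- : #|~: [set v; w1]| = n.-2 by have := cardsC [set v; w1]; rewrite c2 card_ord; lia.
  apply: subset_leq_card; apply/subsetP => u uN; rewrite !inE negb_or.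
  by have [-> _ _] := neighboursP tF sEF vE uN; apply: contraNneq w1N => <-.
have [hf|] := boolP ((h \in F) && (f \notin F)); last first.
  move=> hf; have H2 : (#|neighbours v E| <= 2 * #|[set e in F | v \notin val e]|)%N.
    apply: card_cover => u /(neighboursP tF sEF vE)[_ _ [e' e'F /andP[ue' ve']]].
    by exists e'; rewrite // inE e'F.
  (* In this case [h] lies in [F] only together with [f], so the term for [f] pays for the uncounted
     [h]. *)
  have H4 : (#|[set e in F | v \notin val e]| <= #|E'| + (f \in F))%N.
    have sE : [set e in F | v \notin val e] \subset E' :|: [set e in F | e == h].
      by apply/subsetP => e; rewrite !inE => /andP[-> ->]; case: (e == h).
    apply: leq_trans (subset_leq_card sE) _; apply: leq_trans (leq_card_setU _ _) _.
    rewrite leq_add2l; have [hF|hF] := boolP (h \in F).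
      move: hf; rewrite hF negbK => -> /=; rewrite -(cards1 h).
      by apply: subset_leq_card; apply/subsetP => e; rewrite !inE => /andP[].
    rewrite (_ : [set e in F | e == h] = set0) ?cards0 //.
    by apply/setP => e; rewrite !inE; case: eqP => [->|]; rewrite ?(negbTE hF) ?andbF.
  lia.
(* [w1] needs a second edge besides [h], and it avoids [v] because [f] is absent;
   so [w1] can replace [w2] among the vertices covered by [E']. *)
case/andP: hf => hF fF.
have H2 : (#|w1 |: (neighbours v E :\ w2)| <= 2 * #|E'|)%N.
  apply: card_cover => u; rewrite in_setU1 in_setD1 => /orP[/eqP->|/andP[uw2 uN]].
    have w1h : w1 \in val h by rewrite hE !inE eqxx.
    have [e' [e'F e'h we']] := deg_ge2 tF hF w1h.
    exists e'; rewrite // inE e'F e'h andbT; apply: contraNN fF => ve'.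
    rewrite -(_ : e' = f) //; apply: (edge_eqP vw1) => //; by rewrite fE !inE eqxx ?orbT.
  have [uv [e eE eE'] [e' e'F /andP[ue' ve']]] := neighboursP tF sEF vE uN.
  exists e'; last exact: ue'.
  rewrite inE e'F ve' /=; apply: contraTneq ue' => ->.
  by rewrite hE !inE negb_or uw2 andbT; apply: contraNneq w1N => <-.
have H5 := cardsD1 w2 (neighbours v E).
have H6 : w1 \notin neighbours v E :\ w2 by rewrite in_setD1 (negbTE w1N) andbF.
move: H2; rewrite cardsU1 H6; move: H5; by case: (w2 \in _); lia.
Qed.

End Validity.

(** * Indicator sums, and the facet criterion for edge lists *)

Lemma sum_indicator (R : realFieldType) (T : finType) (P : pred T) (F : {set T}) :
  \sum_(e in F) (P e)%:R = #|[set e in F | P e]|%:R :> R.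
Proof.
rewrite -natr_sum; congr _%:R; rewrite -sum1_card [RHS](eq_bigl (fun e => (e \in F) && P e)).
  by rewrite big_mkcondr; apply: eq_bigr => e _; case: (P e).
by move=> e; rewrite inE.
Qed.

Lemma sum_indicatorM (R : realFieldType) (T : finType) (P : pred T) (x : T -> R) :
  \sum_(e | P e) x e = \sum_e (P e)%:R * x e.
Proof.
by rewrite big_mkcond; apply: eq_bigr => e _; case: (P e); rewrite ?mul1r ?mul0r.
Qed.

Lemma ler_nat_sub2 (R : realFieldType) (i j k m : nat) :
  (i <= j + k + m)%N -> i%:R - j%:R - k%:R <= m%:R :> R.
Proof. by rewrite -(ler_nat R) !natrD; lra. Qed.

Lemma card_edge_gt0 n : (2 <= n)%N -> (0 < #|{: edge n}|)%N.
Proof.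
case: n => [|[|n]] // _.
have [|e _] := @ex_edge n.+2 [set ord0; ord_max]; first by rewrite cards2.
by apply/card_gt0P; exists e.
Qed.

(** Coefficients become functions on vertex sets, so that they can be evaluated on explicit
    lists. *)
Lemma facet_of_tec_lists (R : realFieldType) n (c : {set 'I_n} -> R) (b : R) g :
  (2 <= n)%N -> b != 0 -> (forall x : pt R n, g x = \sum_e c (val e) * x e) ->
  (forall F : {set edge n}, tec F -> \sum_(e in F) c (val e) <= b) ->
  (forall a : {set 'I_n} -> R,
    (forall s, tec_list s -> \sum_(A <- s) c A = b -> \sum_(A <- s) a A = 0) ->
    forall x y, x != y -> a [set x; y] = 0) ->
  defines_facet (@TECSP R n) g b.
Proof.
move=> n2 b0 gE valid span; apply: facet_criterion gE valid _ => //.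
  exact: card_edge_gt0.
(* [a'] extends [a] by 0 to vertex sets that are not edges; no such set occurs in a [tec_list]. *)
move=> a aT e; pose a' (A : {set 'I_n}) := oapp a 0 (insub A : option (edge n)).
have a'E (d : edge n) : a' (val d) = a d by rewrite /a' valK.
have /cards2P[x [y [xy eE]]] := valP e.
rewrite -a'E eE; apply: span xy => s [us c2 ts] cs.
rewrite -(sum_edges_of a' us c2) (eq_bigr _ (fun d _ => a'E d)).
by apply: aT; rewrite // sum_edges_of.
Qed.

(** * Functionals vanishing on tight graphs *)

Section TightWindmills.
Variables (R : realFieldType) (n m : nat) (c a : {set 'I_n} -> R) (v : 'I_n) (U : seq 'I_n).
Hypothesis uvU : uniq (v :: U).
Hypothesis sU : size U = (2 * m).+1.
Hypothesis m0 : (0 < m)%N.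
Hypothesis c1 : {in U, forall x, c [set v; x] = 1}.
Hypothesis cN1 : {in U &, forall x y, x != y -> c [set x; y] = -1}.
Hypothesis aT : forall s, tec_list s -> \sum_(A <- s) c A = m%:R -> \sum_(A <- s) a A = 0.

(** Every triangle has value $1+1-1=1$. *)
Lemma sum_windmill_half (p : seq 'I_n) : ~~ odd (size p) -> uniq p -> {subset p <= U} ->
  \sum_(A <- windmill v p) c A = (size p)./2%:R.
Proof.
move=> ev up sp; apply: sum_windmill => // x y xp yp xy.
by rewrite !c1 ?cN1 ?sp // addrK.
Qed.

(** A windmill missing one vertex of [U] has $m$ triangles and hence value $m$; the ear adds
    $1-1=0$. Thus both families required by [windmills_span] are tight. *)
Lemma tight_windmills_span :
  {in U, forall x, a [set v; x] = 0} /\ {in U &, forall x y, x != y -> a [set x; y] = 0}.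
Proof.
have [vU uU] : v \notin U /\ uniq U by apply/andP.
apply: windmills_span => //; rewrite ?sU; try lia.
- move=> x p px; have := perm_size px; have := perm_uniq px; rewrite uU sU /= => /andP[xp up] sp.
  have sub : {subset p <= U} by move=> u up'; rewrite -(perm_mem px) inE up' orbT.
  apply: aT.
    apply: tec_list_windmill => /=; first lia.
    by rewrite up andbT; apply: contra vU => /sub.
  rewrite sum_windmill_half //; last lia.
  by congr _%:R; lia.
- move=> x y z p px; have := perm_size px; have := perm_uniq px; rewrite uU sU => ux sp.
  have sub : {subset [:: x, y, z & p] <= U} by move=> u up'; rewrite -(perm_mem px).
  have xy : x != y by move: ux; rewrite /= inE negb_or -andbA => /andP[].
  apply: aT.
    apply: tec_list_ear; first by move: sp => /=; lia.
    by rewrite cons_uniq ux andbT; apply: contra vU => /sub.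
  rewrite big_cat (sum_windmill_half (p := [:: y, z & p])).
  + rewrite /= !big_cons big_nil c1 ?cN1 ?sub ?inE ?eqxx ?orbT // addr0 subrr add0r.
    by congr _%:R; move: sp => /=; lia.
  + by move: sp => /=; lia.
  + by case/andP: ux.
  + by move=> u up'; apply: sub; rewrite inE up' orbT.
Qed.

Variables w1 w2 : 'I_n.
Hypothesis vw1 : v != w1.
Hypothesis w1U : w1 \notin U.
Hypothesis w2U : w2 \in U.
Hypothesis cw1 : {in U, forall u, u != w2 -> c [set w1; u] = -1}.
Hypothesis cf : c [set v; w1] = -1.
Hypothesis ch : c [set w1; w2] = 0.

Lemma tight_edges_span :
  a [set v; w1] = 0 /\ {in U, forall u, a [set w1; u] = 0}.
Proof.
have [vU uU] : v \notin U /\ uniq U by apply/andP.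
have nU' x y : x \in U -> y \notin U -> (y == x) = false.
  by move=> xU yU; apply: contraNF yU => /eqP ->.
have vw2 : v != w2 by rewrite nU'.
have w12 : w1 != w2 by rewrite nU'.
have [Ha1 Ha2] := tight_windmills_span.
have aw (p : seq 'I_n) : ~~ odd (size p) -> uniq p -> {subset p <= U} ->
    \sum_(A <- windmill v p) a A = 0.
  move=> ev up sp; rewrite (@sum_windmill _ _ a 0) ?mul0rn // => x y xp yp xy.
  by rewrite !Ha1 ?Ha2 ?sp // !addr0.
(* The triangle on [v], [w1], [w2] has value $-1+1+0=0$, so it is tight together with $m$ triangles
   on the rest of [U]. *)
have afh : a [set v; w1] + a [set w1; w2] = 0.
  have [//||p] := @completion n [:: w2] U _ uU; first by move=> u; rewrite inE => /eqP->.
  rewrite cat1s => pp; have up : uniq (w2 :: p) by rewrite (perm_uniq pp).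
  have [w2p upp] : w2 \notin p /\ uniq p by apply/andP.
  have sp : size p = (2 * m)%N by have := perm_size pp; rewrite sU => -[].
  have sub : {subset p <= U} by move=> u uinp; rewrite -(perm_mem pp) inE uinp orbT.
  have ev : ~~ odd (size p) by rewrite sp mul2n odd_double.
  have ts : tec_list ([:: [set v; w1]; [set v; w2]; [set w1; w2]] ++ windmill v p).
    apply: (@tec_list_windmill _ _ [:: w1, w2 & p]); first by rewrite /= negbK.
    rewrite cons_uniq [uniq _]/= !inE !negb_or vw1 vw2 w12 /= w2p upp.
    by rewrite (contra (sub v) vU) (contra (sub w1) w1U).
  have := aT ts; rewrite !big_cat aw // sum_windmill_half //= !big_cons !big_nil.
  rewrite cf ch c1 // (Ha1 _ w2U) sp mul2n doubleK !addr0 addNr !add0r.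
  by apply.
(* The square has value $1+0-1+1=1$. Of the $2m-1$ other vertices of [U], one vertex [y] is left out
   for parity and the rest form $m-1$ triangles. *)
have ahu u : u \in U -> u != w2 -> a [set w1; w2] + a [set w1; u] = 0.
  move=> uU' uw2.
  have [||[|y p] pp] := @completion n [:: w2; u] U _ uU.
  - by rewrite /= inE eq_sym uw2.
  - by move=> t; rewrite !inE => /orP[]/eqP->.
  - by have := perm_size pp; rewrite sU /=; move: m0; clear; lia.
  rewrite /= in pp; have up : uniq [:: w2, u, y & p] by rewrite (perm_uniq pp).
  have sp : (size p).+2 = (2 * m)%N by have := perm_size pp; rewrite sU => -[].
  have sub : {subset p <= U} by move=> t tp; rewrite -(perm_mem pp) !inE tp !orbT.
  have ev : ~~ odd (size p) by move: sp; clear; lia.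
  move: up; rewrite /= !inE !negb_or -!andbA => /and5P[w2u w2y w2p uy /and3P[up yp upp]].
  have ts : tec_list
      ([:: [set v; w2]; [set w2; w1]; [set w1; u]; [set u; v]] ++ windmill v p).
    apply: tec_list_square => //.
    rewrite /= !inE !negb_or vw1 vw2 (eq_sym w2) w12 w2u w2p up upp.
    by rewrite !(nU' _ _ uU') // !(contra (sub _)).
  have := aT ts; rewrite !big_cat aw // sum_windmill_half //= !big_cons !big_nil.
  rewrite (setUC [set w2]) (setUC [set u]) !Ha1 // ch cw1 // !c1 // !addr0 !add0r.
  by apply; rewrite addNr addr0 nat1r; congr _%:R; move: sp; clear; lia.
(* The $K_{2,3}$ also has value 1 and is completed by $m-1$ triangles. The edges from [w1] to [w2],
   [u] and [t] then have total 0 under [a], and the square relations for [u] and [t] force each of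
   them to vanish. *)
have h0 : a [set w1; w2] = 0.
  have [||[|u [|t p]] pp] := @completion n [:: w2] U _ uU => //.
  - by move=> t; rewrite !inE => /eqP->.
  - by have := perm_size pp; rewrite sU /=; move: m0; clear; lia.
  - by have := perm_size pp; rewrite sU /=; move: m0; clear; lia.
  rewrite /= in pp; have up : uniq [:: w2, u, t & p] by rewrite (perm_uniq pp).
  have sp : (size p).+2 = (2 * m)%N by have := perm_size pp; rewrite sU => -[].
  have sub' : {subset [:: w2, u, t & p] <= U} by move=> x; rewrite (perm_mem pp).
  have sub : {subset p <= U} by move=> x xp; apply: sub'; rewrite !inE xp !orbT.
  have [uU' tU] : u \in U /\ t \in U by split; apply: sub'; rewrite !inE eqxx ?orbT.
  have ev : ~~ odd (size p) by move: sp; clear; lia.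
  move: up; rewrite /= !inE !negb_or -!andbA => /and5P[w2u w2t w2p ut /and3P[up tp upp]].
  have ts : tec_list ([:: [set v; w2]; [set w2; w1]; [set w1; u]; [set u; v];
      [set w1; t]; [set t; v]] ++ windmill v p).
    apply: tec_list_K23 => //.
    rewrite /= !inE !negb_or vw1 vw2 (eq_sym w2 w1) w12 w2u w2t w2p ut up tp upp.
    by rewrite !(nU' _ _ uU') // !(nU' _ _ tU) // !(contra (sub _)).
  have := aT ts; rewrite !big_cat aw // sum_windmill_half //= !big_cons !big_nil.
  rewrite (setUC [set w2]) (setUC [set u]) (setUC [set t]) !Ha1 // ch.
  have [uw2 tw2] : u != w2 /\ t != w2 by rewrite ![_ == w2]eq_sym.
  rewrite !cw1 // !c1 // !addr0 !add0r => H.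
  have {H}at0 : a [set w1; w2] + (a [set w1; u] + a [set w1; t]) = 0.
    by apply: H; rewrite addNr addr0 addNKr nat1r; congr _%:R; move: sp; clear; lia.
  have au := ahu u uU' uw2; have := ahu t tU tw2.
  by move: at0; rewrite addrA au add0r => ->; rewrite addr0.
split=> [|u uU']; first by move: afh; rewrite h0 addr0.
have [->//|uw2] := eqVneq u w2.
by have := ahu u uU' uw2; rewrite h0 add0r.
Qed.

End TightWindmills.

(** * The two facets *)

Lemma facet_even (R : realFieldType) n m (v : 'I_n) : n = (2 * m).+2 -> (0 < m)%N ->
  defines_facet (@TECSP R n)
    (fun x => \sum_(e : edge n | v \in val e) x e - \sum_(e : edge n | v \notin val e) x e)
    m%:R.
Proof.
move=> nE m0; pose c (A : {set 'I_n}) : R := (v \in A)%:R - (v \notin A)%:R.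
apply: (@facet_of_tec_lists _ _ c); first lia.
- by rewrite pnatr_eq0 -lt0n.
- move=> x; rewrite !(sum_indicatorM _ x) -sumrB.
  by apply: eq_bigr => e _; rewrite mulrBl.
- move=> F tF; rewrite sumrB !sum_indicator lerBlDl -natrD ler_nat.
  exact: even_valid.
move=> a aT.
have [//||U] := @completion n [:: v] (enum 'I_n) _ (enum_uniq _).
  by move=> u _; rewrite mem_enum.
rewrite cat1s => pU; have uvU : uniq (v :: U) by rewrite (perm_uniq pU) enum_uniq.
have sU : size U = (2 * m).+1 by have := perm_size pU; rewrite size_enum_ord /=; lia.
have vU : v \notin U by case/andP: uvU.
have [|||Ha1 Ha2] := @tight_windmills_span R n m c a v U uvU sU m0 => //.
- by move=> x _; rewrite /c !inE eqxx /= subr0.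
- move=> x y xU yU _; rewrite /c !inE; have [vx|_] := eqVneq v x; first by rewrite vx xU in vU.
  by have [vy|_] := eqVneq v y; [rewrite vy yU in vU | rewrite /= sub0r].
have inU x : x != v -> x \in U.
  by move=> xv; have := perm_mem pU x; rewrite mem_enum !inE (negbTE xv).
move=> x y; have [->|/inU xU] := eqVneq x v; first by rewrite eq_sym => /inU /Ha1.
have [-> _|/inU yU] := eqVneq y v; first by rewrite setUC Ha1.
exact: Ha2.
Qed.

(** On $K_n-w_1$ the inequality has the form of the even case with the same [m], so the windmill
    argument applies there; the edges at [w1] are treated separately. *)
Lemma facet_odd (R : realFieldType) n m (v w1 w2 : 'I_n) (h f : edge n) :
  n = (2 * m).+3 -> (0 < m)%N ->
  v \notin val h -> val h = [set w1; w2] -> val f = [set v; w1] ->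
  defines_facet (@TECSP R n)
    (fun x => \sum_(e : edge n | (v \in val e) && (e != f)) x e
            - \sum_(e : edge n | (v \notin val e) && (e != h)) x e - x f)
    m%:R.
Proof.
move=> nE m0 vh hE fE.
have w12 : w1 != w2 by have := eqP (valP h); rewrite hE cards2; case: eqP.
have vw1 : v != w1 by have := eqP (valP f); rewrite fE cards2; case: eqP.
have vw2 : v != w2 by move: vh; rewrite hE !inE negb_or => /andP[].
pose c (A : {set 'I_n}) : R := ((v \in A) && (A != val f))%:R
  - ((v \notin A) && (A != val h))%:R - (A == val f)%:R.
have cE (e : edge n) : c (val e) = ((v \in val e) && (e != f))%:R
    - ((v \notin val e) && (e != h))%:R - (e == f)%:R by rewrite /c !(inj_eq val_inj).
apply: (@facet_of_tec_lists _ _ c); first by rewrite nE.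
- by rewrite pnatr_eq0 -lt0n.
- move=> x; rewrite !(sum_indicatorM _ x).
  have -> : x f = \sum_e (e == f)%:R * x e.
    rewrite (bigD1 f) //= eqxx mul1r big1 ?addr0 // => e /negbTE->.
    by rewrite mul0r.
  rewrite -!sumrB; apply: eq_bigr => e _.
  by rewrite cE !mulrBl.
- move=> F tF; rewrite (eq_bigr _ (fun e _ => cE e)) !sumrB !sum_indicator.
  have -> : #|[set e in F | e == f]| = (f \in F).
    have [fF|fF] := boolP (f \in F).
      rewrite (_ : [set e in F | e == f] = [set f]) ?cards1 //.
      by apply/setP => e; rewrite !inE andb_idl // => /eqP->.
    apply/eqP; rewrite cards_eq0; apply/eqP/setP => e; rewrite !inE.
    by apply: contraNF fF => /andP[eF /eqP <-].
  exact: ler_nat_sub2 (odd_valid tF nE vh hE fE).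
move=> a aT.
have [||U] := @completion n [:: v; w1] (enum 'I_n) _ (enum_uniq _).
- by rewrite /= inE vw1.
- by move=> u _; rewrite mem_enum.
rewrite -[_ ++ U]/[:: v, w1 & U] => pU.
have uvwU : uniq [:: v, w1 & U] by rewrite (perm_uniq pU) enum_uniq.
have sU : size U = (2 * m).+1 by have := perm_size pU; rewrite size_enum_ord /=; move: nE; clear; lia.
have [vU w1U uU] : [/\ v \notin U, w1 \notin U & uniq U].
  by move: uvwU; rewrite /= inE negb_or => /and3P[/andP[_ ->] -> ->].
have uvU : uniq (v :: U) by rewrite /= vU.
have nU x y : x \in U -> y \notin U -> (x == y) = false.
  by move=> xU yU; apply: contraNF yU => /eqP <-.
have nU' x y : x \in U -> y \notin U -> (y == x) = false.
  by move=> xU yU; rewrite eq_sym nU.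
have inU x : x != v -> x != w1 -> x \in U.
  by move=> xv xw; have := perm_mem pU x; rewrite mem_enum !inE (negbTE xv) (negbTE xw).
have w2U : w2 \in U by rewrite inU // eq_sym.
have cv x : x \in U -> c [set v; x] = 1.
  by move=> xU; rewrite /c fE hE !inE !eq_set2 !eqxx /= (nU _ _ xU w1U) (negbTE vw1) /= !subr0.
have cU : {in U &, forall x y, x != y -> c [set x; y] = -1}.
  move=> x y xU yU _; rewrite /c fE hE !inE !eq_set2 !(nU' _ v) // !(nU _ v) // !(nU _ w1) //=.
  by rewrite !andbF /= sub0r subr0.
have E := (negbTE vw1, negbTE vw2, negbTE w12, eq_sym w1 v, eq_sym w2 v, eq_sym w2 w1).
have cw1 u : u \in U -> u != w2 -> c [set w1; u] = -1.
  move=> uU' uw2; rewrite /c fE hE !inE !eq_set2 ?eqxx ?E (negbTE uw2).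
  by rewrite ?(nU' _ _ uU' vU) ?(nU _ _ uU' vU) ?(nU _ _ uU' w1U) /= subr0 sub0r.
have cf : c [set v; w1] = -1.
  by rewrite /c fE !inE ?eqxx /= subr0 sub0r.
have ch : c [set w1; w2] = 0.
  by rewrite /c fE hE !inE !eq_set2 ?eqxx ?E /= !subr0.
have [Ha1 Ha2] := tight_windmills_span uvU sU m0 cv cU aT.
have [f0 w1u] : a [set v; w1] = 0 /\ {in U, forall u, a [set w1; u] = 0}.
  exact: (@tight_edges_span R n m c a v U uvU sU m0 cv cU aT w1 w2).
have w1x x : x != w1 -> a [set w1; x] = 0.
  move=> xw1; have [->|xv] := eqVneq x v; first by rewrite setUC.
  by apply: w1u; apply: inU.
have vx x : x != v -> a [set v; x] = 0.
  move=> xv; have [->//|xw1] := eqVneq x w1.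
  by rewrite Ha1 // inU.
(* Every edge contains [v], contains [w1], or lies inside [U]. *)
move=> x y; have [->|xv] := eqVneq x v; first by rewrite eq_sym => /vx.
have [->|xw1] := eqVneq x w1; first by rewrite eq_sym => /w1x.
have [->|yv] := eqVneq y v; first by rewrite setUC => /vx.
have [->|yw1] := eqVneq y w1; first by rewrite setUC => /w1x.
by apply: Ha2; apply: inU.
Qed.

Theorem mainTheorem11 (R : realFieldType) (n : nat) (hn : (4 <= n)%N) :
  (* (i) *)
  (~~ odd n ->
   forall v : 'I_n,
     defines_facet (@TECSP R n)
       (fun x => \sum_(e : edge n | v \in val e) x e
               - \sum_(e : edge n | v \notin val e) x e)
       ((n - 2)%:R / 2))
  /\
  (* (ii) *)
  (odd n ->
   forall (v w1 w2 : 'I_n) (h f : edge n),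
     v \notin val h -> val h = [set w1; w2] -> val f = [set v; w1] ->
     defines_facet (@TECSP R n)
       (fun x => \sum_(e : edge n | (v \in val e) && (e != f)) x e
               - \sum_(e : edge n | (v \notin val e) && (e != h)) x e
               - x f)
       ((n - 3)%:R / 2)).
Proof.
(* Parity turns each bound into a natural number [m], which is positive since [n] is at least 4, and
   at least 5 when odd. *)
have half m : (2 * m)%:R / 2 = m%:R :> R by rewrite natrM mulrAC divff ?mul1r // pnatr_eq0.
split=> [ev v|od v w1 w2 h f vh hE fE].
  have -> : (n - 2 = 2 * (n - 2)./2)%N by lia.
  by rewrite half; apply: facet_even; lia.
have -> : (n - 3 = 2 * (n - 3)./2)%N by lia.
by rewrite half; apply: facet_odd vh hE fE; lia.
Qed.
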